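(* Fix an origin-destination pair $(o,d)$. The equality constraint $$x_{od}^{pt}\ln(x_{od}^{pt})-x_{od}^{pt}\ln(\alpha_{od}-x_{od}^{pt})+\mathrm{VOT}\sum_{l\in\Gamma_{od}}\sum_{s\in S}\frac{1}{2s}\,u_{od,l,s}+x_{od}^{pt}(C_{od}+V_{od}^a)=0$$ can be relaxed to the inequality $$x_{od}^{pt}\ln(x_{od}^{pt})-x_{od}^{pt}\ln(\alpha_{od}-x_{od}^{pt})+\mathrm{VOT}\sum_{l\in\Gamma_{od}}\sum_{s\in S}\frac{1}{2s}\,u_{od,l,s}+x_{od}^{pt}(C_{od}+V_{od}^a)\le 0,$$ which defines a convex region; that is, the set of all $\big(x_{od}^{pt},(u_{od,l,s})_{l\in\Gamma_{od},s\in S}\big)$ with $x_{od}^{pt}\in(0,\alpha_{od})$ and $u_{od,l,s}\in\mathbb R$ satisfying the inequality contains the set satisfying the equality and is convex.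
   Context: $\alpha_{od}>0$ is the demand of the pair, $\Gamma_{od}$ is a finite set (the transit lines used by the reference transit path of $(o,d)$), $S\subset\mathbb R_{>0}$ is a finite set of frequencies, $\mathrm{VOT}>0$, and $C_{od},V_{od}^a\in\mathbb R$ are fixed constants (respectively the non-waiting generalized transit cost and the fixed utility of the competing AMoD mode). The variables are the transit demand $x_{od}^{pt}$ and auxiliary variables $u_{od,l,s}$ (which represent the products of $x_{od}^{pt}$ with binary frequency-selection variables). *)

(* Defs.v *)
From HB Require Import structures.
From mathcomp Require Import all_boot all_order all_algebra finmap.
From mathcomp Require Import all_classical all_reals all_analysis.

Set Implicit Arguments.
Unset Strict Implicit.
Unset Printing Implicit Defensive.

Import Order.TTheory GRing.Theory Num.Theory.

Local Open Scope classical_set_scope.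
Local Open Scope ring_scope.

(* Points (x, u), with u (l, s) standing for u_{od,l,s}. [R^o] is R regarded as
   a module over itself, so that the product is an R-module and [convex_set]
   applies to its subsets. *)
Definition demand_aux_space (R : realType) (Gamma : finType) (S : {fset R})
    : lmodType R :=
  (R^o * {ffun Gamma * S -> R^o})%type.

Definition transit_lhs (R : realType) (Gamma : finType) (S : {fset R})
    (alpha VOT C Va : R) (p : demand_aux_space Gamma S) : R :=
  p.1 * ln p.1 - p.1 * ln (alpha - p.1)
  + VOT * (\sum_(l : Gamma) \sum_(s : S) 1 / (2 * fsval s) * p.2 (l, s))
  + p.1 * (C + Va).

(* [ln] is total in the library, hence the explicit domain 0 < x < alpha. *)
Definition equality_region (R : realType) (Gamma : finType) (S : {fset R})
    (alpha VOT C Va : R) : set (demand_aux_space Gamma S) :=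
  [set p | 0 < p.1 < alpha /\ transit_lhs alpha VOT C Va p = 0].

Definition relaxed_region (R : realType) (Gamma : finType) (S : {fset R})
    (alpha VOT C Va : R) : set (demand_aux_space Gamma S) :=
  [set p | 0 < p.1 < alpha /\ transit_lhs alpha VOT C Va p <= 0].

(* Main.v *)
Require Import Defs.
From HB Require Import structures.
From mathcomp Require Import all_boot all_order all_algebra finmap.
From mathcomp Require Import all_classical all_reals all_analysis.
From mathcomp Require Import ring lra.

(** Over the strip 0 < x < alpha, the left-hand side is the sum of a linear
    function of (x, u) and of the one-variable function
    f x = x ln x - x ln (alpha - x).  If f is convex then so is the sum
    ([convex_transit_lhs]), and the relaxed region, being a sublevel set of a
    convex function on a convex strip, is convex ([convex_set_sublevel]).

    The convexity of f is obtained without second derivatives, from a supporting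
    line at every point z of ]0, alpha[ ([convex_function_support]).  The
    logarithm lies below its tangents: the tangent at x bounds ln z, the tangent
    at alpha - z bounds ln (alpha - x), and multiplying both bounds by x > 0 gives
      f x >= x (ln z - ln (alpha - z)) + (x - z) + x (x - z) / (alpha - z).
    Only the last term is not affine in x, and it is at least
    z (x - z) / (alpha - z), because x (x - z) - z (x - z) is a square.  What
    remains is an affine function of x that equals f at z
    ([logit_cost_support]). *)

Set Implicit Arguments.
Unset Strict Implicit.
Unset Printing Implicit Defensive.

Import Order.TTheory GRing.Theory Num.Theory.

Local Open Scope classical_set_scope.
Local Open Scope ring_scope.
Local Open Scope convex_scope.

Lemma convR_avg (R : realType) (t : {i01 R}) (a b : R^o) :
  a <| t |> b = t%:num * a + (1 - t%:num) * b.
Proof. by []. Qed.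

Lemma convex_set_sublevel (R : realType) (E : lmodType R)
    (D : set (convex_lmodType E)) (f : convex_lmodType E -> R^o) (c : R) :
  convex_set D -> convex_function D f ->
  convex_set [set x : convex_lmodType E | D x /\ f x <= c].
Proof.
move=> cD cf x y t /set_mem[Dx fx] /set_mem[Dy fy]; apply/mem_set; split.
  by apply/set_mem/cD; exact/mem_set.
apply: (le_trans (cf t _ _ (mem_set Dx) (mem_set Dy))).
have -> : c = t%:num * c + (1 - t%:num) * c by ring.
by rewrite convR_avg lerD// ler_wpM2l// subr_ge0.
Qed.

Lemma avg_of_line (R : realType) (c m s a b : R) :
  s * (c + m * (a - (s * a + (1 - s) * b)))
  + (1 - s) * (c + m * (b - (s * a + (1 - s) * b))) = c.
Proof. ring. Qed.

(** The supporting line at z = x <| t |> y lies below f at x and at y, and the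
    average of its values there is its value at z, which is f z. *)
Lemma convex_function_support (R : realType) (D : set R) (f : R -> R) :
  convex_set (D : set R^o) ->
  (forall z, D z -> exists m : R, forall x, D x -> f z + m * (x - z) <= f x) ->
  convex_function (D : set R^o) (f : R^o -> R^o).
Proof.
move=> cD supp t x y Dx Dy.
have [m fm] := supp _ (set_mem (cD x y t Dx Dy)).
have t0 : 0 <= t%:num by [].
have t1 : 0 <= 1 - t%:num by rewrite subr_ge0.
have := lerD (ler_wpM2l t0 (fm _ (set_mem Dx))) (ler_wpM2l t1 (fm _ (set_mem Dy))).
rewrite [X in X <= _](_ : _ = f (x <| t |> y)) ?convR_avg//.
exact: avg_of_line.
Qed.

Lemma convex_set_itvoo (R : realType) (a b : R) :
  convex_set (`]a, b[%classic : set R^o).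
Proof.
move=> x y t /set_mem + /set_mem +; rewrite /= !in_itv/=.
rewrite -(subr_gt0 a x) -(subr_gt0 x b) -(subr_gt0 a y) -(subr_gt0 y b).
move=> /andP[ax xb] /andP[ay yb]; apply/mem_set; rewrite /= in_itv/=.
have shift (s u v c : R) :
    s * (u - c) + (1 - s) * (v - c) = s * u + (1 - s) * v - c by ring.
have flip (s u v c : R) :
    s * (c - u) + (1 - s) * (c - v) = c - (s * u + (1 - s) * v) by ring.
apply/andP; split; rewrite -subr_gt0.
  by have := convR_gt0 t ax ay; rewrite convR_avg shift.
by have := convR_gt0 t xb yb; rewrite convR_avg flip.
Qed.

Lemma ln_le_tangent (R : realType) (z y : R) : 0 < z -> 0 < y ->
  ln y <= ln z + (y - z) / z.
Proof.
move=> z0 y0; rewrite addrC -lerBlDr -ln_div ?posrE//.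
have -> : y / z = 1 + (y - z) / z by field; rewrite gt_eqF.
by apply: le_ln1Dx; rewrite mulrBl divff ?gt_eqF// ltrBrDr addNr divr_gt0.
Qed.

Definition logit_cost (R : realType) (alpha x : R) : R :=
  x * ln x - x * ln (alpha - x).

(** The slope is the derivative of [logit_cost alpha] at z, the only possible
    choice; three elementary inequalities add up to the bound. *)
Lemma logit_cost_support (R : realType) (alpha z x : R) :
  0 < z < alpha -> 0 < x < alpha ->
  logit_cost alpha z
    + (ln z - ln (alpha - z) + 1 + z / (alpha - z)) * (x - z)
  <= logit_cost alpha x.
Proof.
move=> /andP[z0 za] /andP[x0 xa].
have az0 : 0 < alpha - z by rewrite subr_gt0.
have ax0 : 0 < alpha - x by rewrite subr_gt0.
(* With the tangent at x rather than at z, the factor x cancels the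
   denominator and the bound on x ln x is affine in x. *)
have lnx : x * ln z + (x - z) <= x * ln x.
  have := ler_wpM2l (ltW x0) (ln_le_tangent x0 z0).
  have -> : x * (ln x + (z - x) / x) = x * ln x + (z - x).
    by field; rewrite gt_eqF.
  lra.
have lnax : x * ln (alpha - x) <= x * ln (alpha - z) - x * (x - z) / (alpha - z).
  have := ler_wpM2l (ltW x0) (ln_le_tangent az0 ax0).
  by congr (_ <= _); ring.
have sq : z * (x - z) / (alpha - z) <= x * (x - z) / (alpha - z).
  rewrite ler_pM2r ?invr_gt0// -subr_ge0 -mulrBl -expr2.
  exact: sqr_ge0.
rewrite /logit_cost.
have -> : (ln z - ln (alpha - z) + 1 + z / (alpha - z)) * (x - z) =
  (ln z - ln (alpha - z)) * (x - z) + (x - z) + z * (x - z) / (alpha - z).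
  by ring.
lra.
Qed.

Lemma convex_logit_cost (R : realType) (alpha : R) :
  convex_function (`]0, alpha[%classic : set R^o) (logit_cost alpha).
Proof.
apply: convex_function_support; first exact: convex_set_itvoo.
move=> z /=; rewrite in_itv/= => za.
exists (ln z - ln (alpha - z) + 1 + z / (alpha - z)) => x /=.
by rewrite in_itv/= => xa; exact: logit_cost_support.
Qed.

Section transit.
Context (R : realType) (Gamma : finType) (S : {fset R}).
Variables (alpha VOT C Va : R).

Let space := demand_aux_space Gamma S.

Definition linear_cost (p : space) : R :=
  VOT * (\sum_(l : Gamma) \sum_(s : S) 1 / (2 * fsval s) * p.2 (l, s))
  + p.1 * (C + Va).

Lemma linear_cost_conv (t : {i01 R}) (p q : convex_lmodType space) :
  linear_cost (p <| t |> q)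
  = (linear_cost p : R^o) <| t |> (linear_cost q : R^o).
Proof.
have avgM (a k u v : R) :
    k * (a * u + (1 - a) * v) = a * (k * u) + (1 - a) * (k * v) by ring.
rewrite convR_avg /linear_cost.
have -> : \sum_(l : Gamma) \sum_(s : S) 1 / (2 * fsval s) * (p <| t |> q).2 (l, s)
  = t%:num * (\sum_(l : Gamma) \sum_(s : S) 1 / (2 * fsval s) * p.2 (l, s))
  + (1 - t%:num) * (\sum_(l : Gamma) \sum_(s : S) 1 / (2 * fsval s) * q.2 (l, s)).
  rewrite !mulr_sumr -big_split; apply: eq_bigr => l _ /=.
  rewrite !mulr_sumr -big_split; apply: eq_bigr => s _ /=.
  by rewrite !ffunE; exact: avgM.
have -> : (p <| t |> q).1 = t%:num * p.1 + (1 - t%:num) * q.1 by [].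
by ring.
Qed.

Definition demand_strip : set (convex_lmodType space) :=
  [set p | 0 < p.1 < alpha].

Lemma convex_demand_strip : convex_set demand_strip.
Proof.
move=> p q t /set_mem Dp /set_mem Dq; apply/mem_set.
have /set_mem : (p.1 : R^o) <| t |> q.1 \in (`]0, alpha[%classic : set R^o).
  by apply: convex_set_itvoo; apply/mem_set; rewrite /= in_itv.
by rewrite /= in_itv.
Qed.

Lemma convex_transit_lhs :
  convex_function demand_strip
    (transit_lhs alpha VOT C Va : convex_lmodType space -> R^o).
Proof.
have lhsE (p : space) :
    transit_lhs alpha VOT C Va p = logit_cost alpha p.1 + linear_cost p.
  by rewrite /transit_lhs /logit_cost /linear_cost addrA.
have mem_itv (x : R) : 0 < x < alpha -> x \in (`]0, alpha[%classic : set R^o).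
  by move=> xa; apply/mem_set; rewrite /= in_itv.
move=> t p q /set_mem Dp /set_mem Dq.
have avgD (a u u' v v' : R) : a * (u + v) + (1 - a) * (u' + v') =
    (a * u + (1 - a) * u') + (a * v + (1 - a) * v') by ring.
rewrite lhsE linear_cost_conv !convR_avg !lhsE
  (avgD _ (logit_cost alpha p.1)) lerD2r.
exact: (convex_logit_cost t (mem_itv _ Dp) (mem_itv _ Dq)).
Qed.

End transit.

Theorem lemma4p4 (R : realType) (Gamma : finType) (S : {fset R})
    (alpha VOT C Va : R)
    (alpha_gt0 : 0 < alpha)
    (S_gt0 : forall s : R, s \in S -> 0 < s)
    (VOT_gt0 : 0 < VOT) :
  @equality_region R Gamma S alpha VOT C Va
    `<=` @relaxed_region R Gamma S alpha VOT C Va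
  /\ convex_set (@relaxed_region R Gamma S alpha VOT C Va).
Proof.
split; first by move=> p [xa lhs0]; split=> //; rewrite lhs0.
apply: convex_set_sublevel; first exact: convex_demand_strip.
exact: convex_transit_lhs.
Qed.
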